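(* Let $g:\mathbb{R}^N\times\mathbb{R}^M\to\mathbb{R}^d$ be a vector-valued function and consider the set-valued map from $\mathbb{R}^N$ to subsets of $\mathbb{R}^M$ given by $$\mathcal{U}(\mathbf{x})=\{\mathbf{u}\in\mathbb{R}^M\mid g(\mathbf{x},\mathbf{u})\le0\}.$$ If $g$ is continuous, $\mathcal{U}$ is convex-valued, and, for each $\mathbf{x}\in\mathbb{R}^N$, there exists $\mathbf{u}\in\mathbb{R}^M$ that strictly satisfies $\mathcal{U}(\mathbf{x})$, i.e., $g(\mathbf{x},\mathbf{u})<0$, then there exists a $\mathcal{C}^\infty$ function $\bar{\mathbf{u}}:\mathbb{R}^N\to\mathbb{R}^M$ such that $\bar{\mathbf{u}}(\mathbf{x})\in\mathcal{U}(\mathbf{x})$ for all $\mathbf{x}\in\mathbb{R}^N$.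
   Context: Vector inequalities are understood componentwise. A set-valued map is convex-valued if its value at each point is a convex set. *)

(* Defs.v *)
From HB Require Import structures.
From mathcomp Require Import all_boot all_order all_algebra.
From mathcomp Require Import all_classical all_reals all_analysis.
Import Order.TTheory GRing.Theory Num.Theory numFieldNormedType.Exports.

Set Implicit Arguments.
Unset Strict Implicit.
Unset Printing Implicit Defensive.

Local Open Scope classical_set_scope.
Local Open Scope ring_scope.

Definition vle (R : realType) (n : nat) (v w : 'rV[R]_n) : Prop :=
  forall i, v ord0 i <= w ord0 i.

Definition vlt (R : realType) (n : nat) (v w : 'rV[R]_n) : Prop :=
  forall i, v ord0 i < w ord0 i.

(* [is_Ck k f]: every iterated partial derivative of [f] of order at most [k]
   exists everywhere and is continuous. The existence clause is needed because
   ['D_v f x] is total and meaningless where [f] is not derivable. *)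
Fixpoint is_Ck (R : realType) (n m k : nat) (f : 'rV[R]_n -> 'rV[R]_m) : Prop :=
  continuous f /\
  if k is k'.+1 then
    forall i : 'I_n,
      (forall x, derivable f x (delta_mx ord0 i)) /\
      is_Ck k' (fun x => 'D_(delta_mx ord0 i) f x)
  else True.

Definition is_Cinfty (R : realType) (n m : nat) (f : 'rV[R]_n -> 'rV[R]_m) : Prop :=
  forall k, is_Ck k f.

Definition sublevel_map (R : realType) (N M d : nat)
    (g : 'rV[R]_N * 'rV[R]_M -> 'rV[R]_d) (x : 'rV[R]_N) : set 'rV[R]_M :=
  [set u | vle (g (x, u)) 0].

Definition convex_valued (R : realType) (N M : nat)
    (U : 'rV[R]_N -> set 'rV[R]_M) : Prop :=
  forall x, convex_set (U x).

(* Main.v *)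
Require Import Defs.
From HB Require Import structures.
From mathcomp Require Import all_boot all_order all_algebra.
From mathcomp Require Import ring lra.
From mathcomp Require Import all_classical all_reals all_analysis.
Import Order.TTheory GRing.Theory Num.Theory numFieldNormedType.Exports.

Set Implicit Arguments.
Unset Strict Implicit.
Unset Printing Implicit Defensive.

Local Open Scope classical_set_scope.
Local Open Scope ring_scope.

(** The set-valued map [U x = {u | g (x, u) <= 0}] has convex values, and near
    every [a] it admits a constant selection: by continuity, a point [c] with
    [g (a, c) < 0] still satisfies [g (x, c) < 0] for all [x] near [a].
    A smooth selection of such a map could be obtained from a partition of
    unity; successive corrections are used instead, so that no locally finite
    cover has to be constructed and no infinite sum has to be differentiated.

    The elementary step ([blend]) takes a smooth map [u] that selects [U] where
    [h < beta], a smooth map [v] that selects [U] on a set [S], and the cutoff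
    [chi] that is [1] where [h <= alpha] and [0] where [beta <= h]. Then
    [chi u + (1 - chi) v] selects [U] on the union of [S] and [{h <= alpha}]
    ([blend_selects]) and equals [u] on [{h <= alpha}] ([blend_eq]). Applied
    with constants [u] on the balls of a finite cover, it yields a smooth map
    that selects [U] on a given compact set ([compact_selection]). Applied along
    the exhaustion of the space by the compact sets [{|x|^2 <= i}], it yields a
    sequence of maps that is locally stationary and selects [U] on larger and
    larger sets; its limit is a global selection, smooth because smoothness is a
    local property ([global_selection], [Ck_local]).

    The cutoffs are quotients of functions [exp (- 1 / t)] evaluated at smooth
    functions. Their smoothness follows from the closure of [Ck] under sums,
    products and inverses, and from the fact that the functions
    [t ^ (- m) * exp (- 1 / t)] have derivatives that are combinations of
    functions of the same family ([is_derive_flat]). *)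

(** * Scalar functions with continuous partial derivatives *)

(** A scalar version of [is_Ck] in which the partial derivatives are given by
    witnesses rather than by the total operator ['D_v f]: closure properties
    can then be proved by exhibiting the formula of calculus. *)
Fixpoint Ck (R : realType) (n k : nat) (f : 'rV[R]_n -> R) : Prop :=
  continuous f /\
  if k is k'.+1 then
    forall i : 'I_n, exists2 f' : 'rV[R]_n -> R,
      (forall x, is_derive x (delta_mx ord0 i) f (f' x)) & Ck k' f'
  else True.

Definition smooth (R : realType) (n : nat) (f : 'rV[R]_n -> R) : Prop :=
  forall k, Ck k f.

Section closure_properties.
Context {R : realType} {n : nat}.
Implicit Types (f g h : 'rV[R]_n -> R) (k : nat).

Lemma Ck_continuous k f : Ck k f -> continuous f.
Proof. by case: k => [|k] []. Qed.

Lemma CkW k f : Ck k.+1 f -> Ck k f.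
Proof.
elim: k f => [f [fc _]//|k IH f [fc fS]]; split=> // i.
by have [f' df Cf'] := fS i; exists f' => //; exact: IH.
Qed.

Lemma Ck_cst k (c : R) : Ck k (fun _ : 'rV[R]_n => c).
Proof.
elim: k c => [|k IH] c; split=> //; try exact: cst_continuous.
by move=> i; exists (fun=> 0); [move=> x; exact: is_derive_cst|exact: IH].
Qed.

Lemma Ck_coord k (j : 'I_n) : Ck k (fun x : 'rV[R]_n => x ord0 j).
Proof.
have cj : continuous (fun x : 'rV[R]_n => x ord0 j) by exact: coord_continuous.
case: k => [|k]; split=> // i.
exists (fun=> (delta_mx ord0 i : 'rV[R]_n) ord0 j); last exact: Ck_cst.
move=> x; have didx := @derivable_id R 'rV[R]_n x (delta_mx ord0 i).
split; first exact: (derivable_mxP _ _ _).1 didx ord0 j.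
by have := derive_mx didx; rewrite derive_id => /rowP/(_ j); rewrite !mxE.
Qed.

Lemma CkD k f g : Ck k f -> Ck k g -> Ck k (fun x => f x + g x).
Proof.
elim: k f g => [|k IH] f g [fc fS] [gc gS]; split=> //;
  try by move=> x; exact: cvgD (fc x) (gc x).
move=> i; have [f' df Cf'] := fS i; have [g' dg Cg'] := gS i.
exists (fun x => f' x + g' x); last exact: IH.
by move=> x; exact: is_deriveD.
Qed.

Lemma CkM k f g : Ck k f -> Ck k g -> Ck k (fun x => f x * g x).
Proof.
elim: k f g => [|k IH] f g Cf Cg; have [fc fS] := Cf; have [gc gS] := Cg;
  split=> //; try by move=> x; exact: cvgM (fc x) (gc x).
move=> i; have [f' df Cf'] := fS i; have [g' dg Cg'] := gS i.
exists (fun x => f x * g' x + g x * f' x).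
  by move=> x; exact: is_deriveM.
by apply: CkD; apply: IH => //; exact: CkW.
Qed.

Lemma CkB k f g : Ck k f -> Ck k g -> Ck k (fun x => f x - g x).
Proof.
move=> Cf Cg; rewrite (_ : (fun x => _) = fun x => f x + (-1) * g x).
  by apply: CkD => //; apply: CkM => //; exact: Ck_cst.
by apply/funext => x; rewrite mulN1r.
Qed.

Lemma Ck_sum k (I : Type) (s : seq I) (F : I -> 'rV[R]_n -> R) :
  (forall i, Ck k (F i)) -> Ck k (fun x => \sum_(i <- s) F i x).
Proof.
move=> CF; elim: s => [|i s IH].
  by rewrite (_ : (fun x => _) = fun=> 0);
    [exact: Ck_cst|apply/funext => x; rewrite big_nil].
rewrite (_ : (fun x => _) = fun x => F i x + \sum_(j <- s) F j x).
  exact: CkD.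
by apply/funext => x; rewrite big_cons.
Qed.

Lemma CkV k f : (forall x, f x != 0) -> Ck k f -> Ck k (fun x => (f x)^-1).
Proof.
move=> f0; elim: k => [|k IH] Cf; have [fc fS] := Cf; split=> //;
  try by move=> x; exact: cvgV (f0 x) (fc x).
move=> i; have [f' df Cf'] := fS i.
exists (fun x => (-1) * ((f x)^-1 * (f x)^-1) * f' x).
  move=> x; have [dfx <-] := df x; split; first exact: derivableV.
  by rewrite deriveV// mulN1r -invfM -expr2.
by do !apply: CkM => //; [exact: Ck_cst|apply: IH; exact: CkW..].
Qed.

(** Differentiability only depends on the germs of [f]: the derivative of a
    local model is a local model of the derivative. *)
Lemma Ck_local k f :
  (forall a : 'rV[R]_n, exists2 g, Ck k g & \forall x \near a, g x = f x) ->
  Ck k f.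
Proof.
elim: k f => [|k IH] f loc; (have fc : continuous f; [
    move=> a; have [g /Ck_continuous gc gf] := loc a;
    rewrite /continuous_at -(nbhs_singleton gf);
    exact: cvg_trans (near_eq_cvg gf) (gc a) | split=> //]).
move=> i; exists (fun x => 'D_(delta_mx ord0 i) f x).
  move=> a; have [g [_ /(_ i)[g' dg _]] gf] := loc a.
  by have [df _] := near_eq_is_derive gf (dg a); exact: derivableP.
apply: IH => a; have [g [_ /(_ i)[g' dg Cg']] gf] := loc a.
exists g' => //; apply: filterS (near_join gf) => x gfx.
by have [_ ->] := near_eq_is_derive gfx (dg x).
Qed.

End closure_properties.

Lemma is_Ck_of_coord (R : realType) (n m k : nat)
    (u : 'rV[R]_n -> 'rV[R]_m) :
  (forall j, Ck k (fun x => u x ord0 j)) -> is_Ck k u.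
Proof.
have cont (v : 'rV[R]_n -> 'rV[R]_m) :
    (forall j, continuous (fun x => v x ord0 j)) -> continuous v.
  move=> vc a; apply/(cvg_ballP (F := nbhs a)) => e e0.
  have vj j : \forall x \near a, ball (v a ord0 j) e (v x ord0 j).
    exact: cvg_ball (vc j a) _ e0.
  apply: (filterS (F := nbhs a)) (filter_forall _ vj) => x vx.
  by split=> // i j; rewrite !ord1.
elim: k u => [|k IH] u Cu; split=> //;
  try by apply: cont => j; exact: Ck_continuous (Cu j).
move=> i.
have der x : derivable u x (delta_mx ord0 i).
  apply/derivable_mxP => i0 j; rewrite ord1.
  by have [_ /(_ i)[f' df _]] := Cu j; have [] := df x.
split=> //; apply: IH => j; have [_ /(_ i)[f' df Cf']] := Cu j.
rewrite (_ : (fun x => _) = f')//; apply/funext => x.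
by rewrite derive_mx// mxE; have [_] := df x.
Qed.

(** * The flat function [exp (- 1 / t)] *)

(** The functions [t ^ (- m) * exp (- 1 / t)], extended by zero to the
    nonpositive reals, are considered together because the derivatives of one
    of them are linear combinations of the others. *)
Definition flat (R : realType) (m : nat) (t : R) : R :=
  if 0 < t then t ^- m * expR (- t^-1) else 0.

Section flat_function.
Context {R : realType}.
Implicit Types (t : R) (m : nat).

Lemma flat_le0 m t : t <= 0 -> flat m t = 0.
Proof. by rewrite /flat => /le_gtF ->. Qed.

Lemma flat_gt0 m t : 0 < t -> 0 < flat m t.
Proof.
by move=> t0; rewrite /flat t0 mulr_gt0 ?expR_gt0// invr_gt0 exprn_gt0.
Qed.

Lemma flat_ge0 m t : 0 <= flat m t.
Proof. by have [/flat_gt0/ltW//|/flat_le0 ->] := ltP 0 t. Qed.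

(** The exponential dominates the power [1 / t ^ (m + 1)], whence flatness at
    the origin. *)
Lemma flat_le_linear m t : `|flat m t| <= (m.+1)`!%:R * `|t|.
Proof.
have [t0|/flat_le0 ->] := ltP 0 t; last by rewrite normr0 mulr_ge0.
rewrite (gtr0_norm t0) gtr0_norm ?flat_gt0// /flat t0 expRN.
have tm0 : 0 < t ^+ m by exact: exprn_gt0.
have E : t ^- m.+1 / (m.+1)`!%:R <= expR t^-1.
  rewrite -exprVn (le_trans _ (expR_ge1Dxn m _)) ?invr_ge0 ?(ltW t0)//.
  by rewrite lerDr.
rewrite ler_pdivrMr ?expR_gt0//.
have c0 : 0 < (m.+1)`!%:R :> R by rewrite ltr0n fact_gt0.
apply: le_trans (ler_wpM2l _ E); last by rewrite mulr_ge0 ?ltW.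
rewrite exprS le_eqVlt; apply/orP; left; apply/eqP; field.
by rewrite !gt_eqF ?exprn_gt0.
Qed.

Lemma flat_continuous0 m : {for 0, continuous (@flat R m)}.
Proof.
rewrite /prop_for /continuous_at flat_le0//; apply/cvgr0Pnorm_le => e e0.
have c0 : 0 < (m.+1)`!%:R :> R by rewrite ltr0n fact_gt0.
near=> t; apply: le_trans (flat_le_linear m t) _.
rewrite mulrC -ler_pdivlMr//; near: t.
apply: (@cvgr0_norm_le _ _ _ (nbhs (0 : R)) _ id); first exact: cvg_id.
exact: divr_gt0.
Unshelve. all: by end_near. Qed.

Lemma is_derive_flat m t :
  is_derive t 1 (@flat R m) (flat m.+2 t - m%:R * flat m.+1 t).
Proof.
have [t0|t0|->] := ltgtP t 0.
- rewrite !flat_le0 ?ltW// mulr0 subr0.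
  apply: near_eq_is_derive (is_derive_cst 0 t 1).
  near=> s; rewrite flat_le0//; apply: ltW; near: s; exact: lt_nbhsl.
- pose f := fun s : R => s ^- m * expR (- s^-1).
  apply: (@near_eq_is_derive _ _ _ f).
    near=> s; rewrite /flat ifT//; near: s; exact: lt_nbhsr.
  have dV : is_derive t 1 (fun s : R => s^-1) (- t ^- 2).
    have := is_deriveV (f := id) (lt0r_neq0 t0) (is_derive_id t 1).
    by rewrite /GRing.scale/= mulr1.
  have dE : is_derive t 1 (fun s : R => expR (- s^-1)) (expR (- t^-1) * t ^- 2).
    rewrite -[t ^- 2]opprK.
    have dN : is_derive t 1 (fun s : R => - s^-1) (- - t ^- 2).
      exact: is_deriveN.
    exact: (@is_derive1_comp _ expR _ t _ _ (is_derive_expR _) dN).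
  have dX : is_derive t 1 (fun s : R => s ^- m) (- (m%:R * t ^- m.+1)).
    have := is_deriveX m dV; rewrite exprfctE.
    rewrite (_ : (fun s => _) = (fun s : R => s ^- m)); last first.
      by apply/funext => s; rewrite exprVn.
    move=> d; apply: is_derive_eq d _; rewrite /GRing.scale/=.
    case: (m) => [|k]; first by rewrite !mul0r oppr0.
    by rewrite mulrN -mulrA -!exprVn -exprD addn2.
  have df : is_derive t 1 f _ := is_deriveM dX dE.
  apply: is_derive_eq df _.
  by rewrite /flat t0 /GRing.scale/= !exprS; field; rewrite !gt_eqF ?exprn_gt0.
- (* The slope of [flat m] between [0] and [t] is [flat m.+1 t]. *)
  rewrite !flat_le0// mulr0 subr0; apply/is_derive1_caratheodory.
  exists (flat m.+1); split; last exact: flat_le0.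
    move=> z; rewrite [flat m 0]flat_le0// !subr0 /flat.
    case: ltP => z0; last by rewrite mul0r.
    by rewrite exprS; field; rewrite !gt_eqF ?exprn_gt0.
  exact: flat_continuous0.
Unshelve. all: by end_near. Qed.

Lemma flat_continuous m : continuous (@flat R m).
Proof.
move=> t; apply/differentiable_continuous/derivable1_diffP.
by have [] := is_derive_flat m t.
Qed.

End flat_function.

(** * Smooth cutoffs *)

(** Partial derivatives are one-dimensional derivatives of restrictions to
    lines, which reduces a chain rule to its one-variable case. *)
Lemma is_derive_line (R : numFieldType) (V W : normedModType R) (f : V -> W)
    (x v : V) (d : W) :
  is_derive x v f d <-> is_derive (0 : R) 1 (fun t => f (t *: v + x)) d.
Proof.
have E : 'D_v f x = 'D_1 (fun t : R => f (t *: v + x)) 0.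
  rewrite /derive; set F := (X in lim (X @ _)); set G := (X in _ = lim (X @ _)).
  suff -> : F = G by [].
  apply: funext => h; rewrite /F /G /=.
  by rewrite addr0 scale0r add0r [_%:A]mulr1.
by split=> -[df <-]; split=> //; [exact: (derivable1P _ _ _).1|
  exact: (derivable1P _ _ _).2].
Qed.

Lemma is_derive_comp1 (R : realType) (V : normedModType R) (f : V -> R)
    (phi : R -> R) (x v : V) (a b : R) :
  is_derive (f x) 1 phi a -> is_derive x v f b ->
  is_derive x v (fun y => phi (f y)) (a * b).
Proof.
move=> dphi /is_derive_line df; apply/is_derive_line.
by apply: (@is_derive1_comp _ phi _ (0 : R)); rewrite ?scale0r ?add0r.
Qed.

Section cutoff.
Context {R : realType} {n : nat}.
Implicit Types (h : 'rV[R]_n -> R) (k m : nat).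

Lemma Ck_flat k m h : Ck k h -> Ck k (fun x => flat m (h x)).
Proof.
elim: k m h => [|k IH] m h Ch; have [hc hS] := Ch;
  (have fc : continuous (fun x => flat m (h x)) by
    move=> x; exact: (continuous_comp (hc x) (@flat_continuous _ m (h x))));
  split=> // i; have [h' dh Ch'] := hS i.
exists (fun x => (flat m.+2 (h x) - m%:R * flat m.+1 (h x)) * h' x).
  by move=> x; apply: is_derive_comp1 (is_derive_flat _ _) (dh x).
have Chk := CkW Ch.
by apply: CkM => //; apply: CkB; [|apply: CkM; [exact: Ck_cst|]]; exact: IH.
Qed.

(** Dividing by the sum makes the cutoff exactly [1], not merely positive, on
    the sublevel set [h <= alpha]: blending with it can then leave a map
    unchanged there. *)
Definition cutoff h (alpha beta : R) (x : 'rV[R]_n) : R :=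
  flat 0 (beta - h x) / (flat 0 (beta - h x) + flat 0 (h x - alpha)).

Variables (h : 'rV[R]_n -> R) (alpha beta : R).
Hypothesis lt_ab : alpha < beta.

(* One of the two summands is positive because [h x] cannot be both at least
   [beta] and at most [alpha]. *)
Let denominator_gt0 x : 0 < flat 0 (beta - h x) + flat 0 (h x - alpha).
Proof.
have [hb|bh] := ltP (h x) beta.
  by rewrite ltr_pwDl ?flat_ge0// flat_gt0// subr_gt0.
by rewrite ltr_wpDl ?flat_ge0// flat_gt0// subr_gt0 (lt_le_trans lt_ab).
Qed.

Lemma cutoff_smooth : smooth h -> smooth (cutoff h alpha beta).
Proof.
move=> sh k; have Cb := CkB (Ck_cst k beta) (sh k).
have Ca := CkB (sh k) (Ck_cst k alpha).
apply: CkM; first exact: Ck_flat.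
apply: CkV; first by move=> x; rewrite gt_eqF.
by apply: CkD; exact: Ck_flat.
Qed.

Lemma cutoff_ge0 x : 0 <= cutoff h alpha beta x.
Proof. by rewrite divr_ge0 ?flat_ge0// ltW. Qed.

Lemma cutoff_le1 x : cutoff h alpha beta x <= 1.
Proof. by rewrite ler_pdivrMr// mul1r lerDl flat_ge0. Qed.

Lemma cutoff_eq1 x : h x <= alpha -> cutoff h alpha beta x = 1.
Proof.
move=> ha; rewrite /cutoff; have := denominator_gt0 x.
rewrite (flat_le0 0 (t := h x - alpha)) ?subr_le0// addr0 => d0.
by rewrite divff// gt_eqF.
Qed.

Lemma cutoff_eq0 x : beta <= h x -> cutoff h alpha beta x = 0.
Proof. by move=> bh; rewrite /cutoff flat_le0 ?mul0r// subr_le0. Qed.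

End cutoff.

(** * Gluing selections *)

Definition smooth_map (R : realType) (n m : nat) (u : 'rV[R]_n -> 'rV[R]_m) :=
  forall j, smooth (fun x => u x ord0 j).

Definition selects (X Y : Type) (P : X -> set Y) (S : set X) (u : X -> Y) :=
  forall x, S x -> P x (u x).

Section blend.
Context {R : realType} {n m : nat}.
Implicit Types (h : 'rV[R]_n -> R) (u v : 'rV[R]_n -> 'rV[R]_m).

Definition blend h (alpha beta : R) u v (x : 'rV[R]_n) : 'rV[R]_m :=
  cutoff h alpha beta x *: u x + (1 - cutoff h alpha beta x) *: v x.

Variables (h : 'rV[R]_n -> R) (alpha beta : R).
Hypothesis lt_ab : alpha < beta.

Lemma blend_smooth u v :
  smooth h -> smooth_map u -> smooth_map v ->
  smooth_map (blend h alpha beta u v).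
Proof.
move=> sh su sv j k; have Cc := cutoff_smooth lt_ab sh k.
rewrite (_ : (fun x => _) = fun x => cutoff h alpha beta x * u x ord0 j +
    (1 - cutoff h alpha beta x) * v x ord0 j); last first.
  by apply/funext => x; rewrite !mxE.
apply: CkD; apply: CkM => //; try exact: su; try exact: sv.
by apply: CkB => //; exact: Ck_cst.
Qed.

Lemma blend_eq u v x : h x <= alpha -> blend h alpha beta u v x = u x.
Proof.
by move=> ha; rewrite /blend cutoff_eq1// subrr scale0r addr0 scale1r.
Qed.

(** Where the cutoff vanishes the value is that of [v], where it is [1] the
    value is that of [u], and in between both are selections, so convexity
    applies. *)
Lemma blend_selects (P : 'rV[R]_n -> set 'rV[R]_m) (S : set 'rV[R]_n) u v :
  convex_valued P ->
  selects P [set x | h x < beta] u -> selects P S v ->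
  selects P ([set x | h x <= alpha] `|` S) (blend h alpha beta u v).
Proof.
move=> convP Pu Pv x /= xS.
have [hb|bh] := ltP (h x) beta; last first.
  have Sx : S x.
    by case: xS => //= /(le_trans bh)/le_lt_trans/(_ lt_ab); rewrite ltxx.
  by rewrite /blend cutoff_eq0// scale0r add0r subr0 scale1r; exact: Pv.
have [ha|ah] := leP (h x) alpha; first by rewrite blend_eq//; exact: Pu.
have Sx : S x by case: xS => // /(lt_le_trans ah); rewrite ltxx.
have := @convP x (u x) (v x)
  (Itv01 (cutoff_ge0 h lt_ab x) (cutoff_le1 h lt_ab x)).
by rewrite !inE; apply; [exact: Pu|exact: Pv].
Qed.

End blend.

(** * From local to global selections *)

(** The squared Euclidean distance serves as exhaustion function and defines
    neighbourhoods because, unlike the norm, it is smooth. *)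
Definition sqdist (R : realType) (n : nat) (a x : 'rV[R]_n) : R :=
  \sum_(i < n) (x ord0 i - a ord0 i) ^+ 2.

Section sqdist.
Context {R : realType} {n : nat}.
Implicit Types a x : 'rV[R]_n.

Lemma sqdist_smooth a : smooth (sqdist a).
Proof.
move=> k; apply: Ck_sum => i.
rewrite (_ : (fun x => _) =
    fun x => (x ord0 i - a ord0 i) * (x ord0 i - a ord0 i)); last first.
  by apply/funext => x; rewrite expr2.
by apply: CkM; apply: CkB; solve [exact: Ck_coord | exact: Ck_cst].
Qed.

Lemma sqdist_continuous a : continuous (sqdist a).
Proof. exact: Ck_continuous (sqdist_smooth a 0). Qed.

Lemma sqdist_coord a x i : (x ord0 i - a ord0 i) ^+ 2 <= sqdist a x.
Proof.
by rewrite /sqdist (bigD1 i)//= lerDl sumr_ge0// => j _; exact: sqr_ge0.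
Qed.

Lemma sqdist_self a : sqdist a a = 0.
Proof. by rewrite /sqdist big1// => i _; rewrite subrr expr0n. Qed.

Lemma open_sqdist_lt a (r : R) : open [set x | sqdist a x < r].
Proof.
by apply: (open_comp (f := sqdist a)) (open_lt (y := r)) => x _;
  exact: sqdist_continuous.
Qed.

Lemma compact_sqdist_le a (r : R) : compact [set x | sqdist a x <= r].
Proof.
apply: bounded_closed_compact; last first.
  by apply: (closed_comp (f := sqdist a)) (closed_le (y := r)) => x _;
    exact: sqdist_continuous.
exists (`|a| + (r + 1)); split; first exact: num_real.
move=> M /ltW ltM x /= xr; apply: le_trans ltM.
rewrite -(subrK a x) (le_trans (ler_normD _ _))// addrC lerD2l.
have r0 : 0 <= r.
  by apply: le_trans xr; rewrite sumr_ge0// => j _; exact: sqr_ge0.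
rewrite [leLHS]/Num.Def.normr/= mx_normrE bigmax_le ?addr_ge0// => -[i j] _ /=.
rewrite ord1 !mxE; have := le_trans (sqdist_coord a x j) xr.
set t := _ - _ => tr; rewrite ler_norml; apply/andP; split; nra.
Qed.

Lemma nbhs_sqdist a (W : set 'rV[R]_n) :
  nbhs a W -> exists2 r : R, 0 < r & [set x | sqdist a x < r] `<=` W.
Proof.
move=> /nbhs_ballP[e /= e0 eW]; exists (e ^+ 2); first exact: exprn_gt0.
move=> x /= xe; apply: eW; split=> // i j; rewrite ord1.
have := le_lt_trans (sqdist_coord a x j) xe.
rewrite /ball/= distrC; set t := _ - _ => te.
by rewrite ltr_norml; apply/andP; split; nra.
Qed.

End sqdist.

Section global_selection.
Context {R : realType} {n m : nat}.
Variable P : 'rV[R]_n -> set 'rV[R]_m.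
Hypothesis convP : convex_valued P.
Hypothesis locP : forall a : 'rV[R]_n, exists c, \forall x \near a, P x c.

Lemma cst_smooth_map (c : 'rV[R]_m) : smooth_map (fun _ : 'rV[R]_n => c).
Proof. by move=> j k; exact: Ck_cst. Qed.

(** Each point is the centre of a ball on which some constant is a selection;
    finitely many smaller concentric balls cover [K]. Overwriting a map by that
    constant on one of the smaller balls at a time, through [blend], never
    destroys what has been achieved on the balls treated before. *)
Lemma compact_selection (K : set 'rV[R]_n) : compact K ->
  exists2 u, smooth_map u & selects P K u.
Proof.
have /choice[cr crP] a : exists cr : 'rV[R]_m * R,
    0 < cr.2 /\ selects P [set x | sqdist a x < cr.2] (fun=> cr.1).
  by have [c /nbhs_sqdist[r r0 rP]] := locP a; exists (c, r).
pose core a := [set x | sqdist a x < (cr a).2 / 2].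
have half a : (cr a).2 / 2 < (cr a).2.
  by have [r0 _] := crP a; rewrite ltr_pdivrMr// ltr_pMr// ltr1n.
rewrite compact_cover => /(_ _ setT core) [|x _|D _ KD].
- by move=> a _; exact: open_sqdist_lt.
- by exists x => //=; rewrite /core/= sqdist_self divr_gt0//; have [] := crP x.
suff [u su Pu] : exists2 u, smooth_map u &
    selects P [set x | exists2 a, a \in finmap.enum_fset D & core a x] u.
  by exists u => // x /KD[a /= aD xa]; apply: Pu; exists a.
elim: (finmap.enum_fset D) => [|a s [u su Pu]].
  by exists (fun=> 0); [exact: cst_smooth_map|move=> x [a]].
have [_ ca] := crP a.
exists (blend (sqdist a) ((cr a).2 / 2) (cr a).2 (fun=> (cr a).1) u).
  by apply: blend_smooth => //; [exact: sqdist_smooth|exact: cst_smooth_map].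
move=> x [b]; rewrite inE => bs xb.
apply: (blend_selects (half a) convP ca Pu).
by move: bs => /predU1P[ba|bs]; [left; rewrite -ba /= ltW|right; exists b].
Qed.

(** With [K i] the ball [q <= i], a map [u i] that is a selection on [K i] is
    extended by blending it, between the levels [i - 1] and [i] of [q], into a
    selection [v i.+1] on [K i.+1]. Since [u i.+1] agrees with [u i] where
    [q <= i - 1], the sequence is locally stationary and its limit is smooth. *)
Lemma global_selection : exists2 u, smooth_map u & forall x, P x (u x).
Proof.
pose q := sqdist (0 : 'rV[R]_n); pose K (i : nat) := [set x | q x <= i%:R].
have /choice[v vP] (i : nat) : exists v, smooth_map v /\ selects P (K i) v.
  have [v] := compact_selection (@compact_sqdist_le R n 0 i%:R).
  by exists v.
pose u := fix u i := if i is j.+1 then blend q (j%:R - 1) j%:R (u j) (v j.+1)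
  else v 0%N.
have gap (j : nat) : j%:R - 1 < j%:R :> R by rewrite ltrBlDr ltrDl.
have su i : smooth_map (u i).
  elim: i => [|i IH] /=; first by have [] := vP 0%N.
  by apply: blend_smooth => //; [exact: sqdist_smooth|have [] := vP i.+1].
have Pu i : selects P (K i) (u i).
  elim: i => [|i IH]; first by have [] := vP 0%N.
  have [_ vi] := vP i.+1 => x xi.
  apply: (blend_selects (gap i) convP _ vi); last by right.
  by move=> y /ltW; exact: IH.
have stable i j x : q x <= i%:R - 1 -> (i <= j)%N -> u j x = u i x.
  move=> xi /subnK <-; elim: (j - i)%N => [//|k IH].
  by rewrite addSn /= blend_eq// (le_trans xi)// lerD2r ler_nat leq_addl.
(* The value at [x] is read off beyond the index from which the sequence is
   stationary near [x]; the strict inequality [qN] makes this an open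
   condition on [x]. *)
pose N x := (Num.trunc (q x)).+2.
have qN x : q x < (N x)%:R - 1 by rewrite /N -natr1 addrK; exact: truncnS_gt.
exists (fun x => u (N x) x).
  move=> j k; apply: Ck_local => a; exists (fun x => u (N a) x ord0 j).
    exact: su.
  have : \forall x \near a, q x < (N a)%:R - 1.
    by apply: open_nbhs_nbhs; split; [exact: open_sqdist_lt|exact: qN].
  apply: filterS => x xa; congr (_ _ _).
  have [le|/ltnW le] := leqP (N a) (N x).
    by rewrite (stable _ _ _ (ltW xa) le).
  by rewrite (stable _ _ _ (ltW (qN x)) le).
move=> x; apply: (Pu (N x)); rewrite /K /= (le_trans (ltW (qN x)))//.
exact: ltW.
Qed.

End global_selection.

(** * Smooth selections of strictly feasible convex systems *)

Theorem lemma6p5 (R : realType) (N M d : nat)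
    (g : 'rV[R]_N * 'rV[R]_M -> 'rV[R]_d)
    (g_cont : continuous g)
    (U_convex : convex_valued (sublevel_map g))
    (g_strict : forall x : 'rV[R]_N, exists u : 'rV[R]_M, vlt (g (x, u)) 0) :
  exists ubar : 'rV[R]_N -> 'rV[R]_M,
    is_Cinfty ubar /\ forall x : 'rV[R]_N, sublevel_map g x (ubar x).
Proof.
(* Strict feasibility is an open condition on the parameter, so that a strictly
   feasible point at [a] remains feasible at all nearby parameters. *)
have loc (a : 'rV[R]_N) : exists c, \forall x \near a, sublevel_map g x c.
  have [c gc] := g_strict a; exists c.
  have coord i : \forall x \near a, g (x, c) ord0 i < 0.
    have gi : {for a, continuous (fun x => g (x, c) ord0 i)}.
      have pc : {for a, continuous (fun x : 'rV[R]_N => (x, c))}.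
        exact: (cvg_pair (F := nbhs a) (G := nbhs a) (H := nbhs c)
        (f := id) (g := fun=> c) cvg_id (cvg_cst c)).
      have gc' : {for a, continuous (fun x => g (x, c))}.
        exact: (continuous_comp pc (g_cont (a, c))).
      exact: (continuous_comp gc' (@coord_continuous R 1 d ord0 i (g (a, c)))).
    by apply: (cvgr_lt _ gi); have := gc i; rewrite !mxE.
  apply: (filterS (F := nbhs a)) (filter_forall _ coord) => x xc i.
  by rewrite mxE ltW.
have [u su Pu] := global_selection U_convex loc.
by exists u; split=> // k; apply: is_Ck_of_coord => j; exact: su.
Qed.
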